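(* Let $m\ge1$ be an integer, let $c>1$ be a real constant, and let $N=\lfloor c\,2^m n\rfloor$. Then there is a constant $M=M(c,m)>0$ such that $$\frac{1}{c^{1/m}}\Big(1+\sqrt{\frac{M\log n}{n}}\,\Big)\quad\text{and}\quad \frac{1}{c^{1/m}}\Big(1-\sqrt{\frac{M\log n}{n}}\,\Big)$$ are a weak Ramsey upper threshold and a weak Ramsey lower threshold of $K_m+\overline{K}_n$ in $\mathcal{G}(N,p)$, respectively.
   Context: All graphs are finite and simple. $K_m+\overline{K}_n$ is the graph obtained from the complete graph $K_m$ by adding $n$ additional vertices (pairwise non-adjacent) and joining each of them to every vertex of $K_m$. $\mathcal{G}(N,p)$ is the Erdős–Rényi random graph space on a labelled vertex set of size $N$, in which each edge of $K_N$ appears independently with probability $p$. $G\subseteq F$ means that $F$ contains a copy of $G$ as a (not necessarily induced) subgraph. Probability functions $p_u=p_u(N)$ and $p_\ell=p_\ell(N)$ are called a weak Ramsey upper threshold and a weak Ramsey lower threshold of $G$ in $\mathcal{G}(N,p)$, respectively, if $$\lim_{N\to\infty}\Pr[F\in\mathcal{G}(N,p/2): G\subseteq F]=\begin{cases}1&\text{for } p\ge p_u,\\ 0&\text{for } p\le p_\ell,\end{cases}$$ where $p=p(N)\in[0,1]$ may depend on $N$ (note the edge probability $p/2$). Here $G=K_m+\overline{K}_n$ depends on $n$, with $N=\lfloor c2^mn\rfloor$ and $m,c$ fixed, so the limit is taken as $n\to\infty$; the two functions are considered for $n$ large enough that they lie in $[0,1]$. *)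

(* Defs.v *)
From HB Require Import structures.
From mathcomp Require Import all_boot all_order all_algebra.
From mathcomp Require Import all_classical all_reals all_analysis.

Set Implicit Arguments.
Unset Strict Implicit.
Unset Printing Implicit Defensive.

Import Order.TTheory GRing.Theory Num.Theory.
Import numFieldNormedType.Exports.

Local Open Scope ring_scope.

Section SimpleGraphs.
Variable V : finType.

Record sgraph := SGraph {
  edges : {set {set V}};
  edges_pairs : edges \subset [set e : {set V} | #|e| == 2%N] }.

HB.instance Definition _ := [isSub for edges].
HB.instance Definition _ := [Finite of sgraph by <:].

End SimpleGraphs.

Definition contains_copy (V W : finType) (G : sgraph V) (F : sgraph W) : bool :=
  [exists f : {ffun V -> W},
    injectiveb f && [forall e in edges G, f @: e \in edges F]].

(* K_m + \overline{K}_n: the vertices of K_m are the [inl i], the added ones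
   the [inr j]; a pair of vertices is an edge unless both are added ones. *)
Definition Kjoin_edges (m n : nat) : {set {set ('I_m + 'I_n)}} :=
  [set e : {set ('I_m + 'I_n)} | (#|e| == 2%N) & [exists i, inl i \in e]].

Lemma Kjoin_edges_pairs (m n : nat) :
  Kjoin_edges m n \subset [set e : {set ('I_m + 'I_n)} | #|e| == 2%N].
Proof. by apply/fintype.subsetP => e; rewrite !inE => /andP[]. Qed.

Definition Kjoin (m n : nat) : sgraph ('I_m + 'I_n)%type :=
  SGraph (Kjoin_edges_pairs m n).

Section RandomGraphs.
Variables (R : realType) (N : nat).

(* The mass of F in G(N, p): independent edges give a product over all pairs. *)
Definition er_mass (p : R) (F : sgraph 'I_N) : R :=
  \prod_(e : {set 'I_N} | #|e| == 2%N) (if e \in edges F then p else 1 - p).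

Definition er_prob (p : R) (A : pred (sgraph 'I_N)) : R :=
  \sum_(F | A F) er_mass p F.

Lemma er_mass_ge0 (p : R) (F : sgraph 'I_N) : 0 <= p <= 1 -> 0 <= er_mass p F.
Proof.
move=> /andP[p0 p1]; apply: prodr_ge0 => e _.
by case: ifP => _ //; rewrite subr_ge0.
Qed.

Lemma er_prob_predT (p : R) : er_prob p predT = 1.
Proof.
pose pairs := [set e : {set 'I_N} | #|e| == 2%N].
pose F e : R := if e \in pairs then p else 0.
pose G e : R := if e \in pairs then 1 - p else 1.
have FG : \prod_e (F e + G e) = 1.
  by apply: big1 => e _; rewrite /F /G; case: ifP; rewrite ?subrKC ?add0r.
have -> : 1 = \sum_(J : {set {set 'I_N}}) \prod_e (if e \in J then F e else G e).
  by rewrite -[LHS]FG bigA_distr.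
rewrite /er_prob [RHS](bigID (fun J : {set {set 'I_N}} => J \subset pairs)) /=.
rewrite [X in _ = _ + X]big1 => [|J /fintype.subsetPn[e eJ eP]]; last first.
  by rewrite (bigD1 e) //= eJ /F (negbTE eP) mul0r.
rewrite addr0 (reindex_omap (@edges 'I_N) insub) /=; last first.
  by move=> J JP; rewrite -[J]/(val (SGraph JP)) valK.
apply: eq_big => [E|E _].
  by rewrite valK eqxx andbT edges_pairs.
rewrite /er_mass big_mkcond; apply: eq_bigr => e _.
have EP := edges_pairs E; rewrite /F /G !inE.
case: ifPn => // ne2; case: ifPn => // eE.
by have := fintype.subsetP EP e eE; rewrite inE (negbTE ne2).
Qed.

End RandomGraphs.

Local Open Scope classical_set_scope.

Section WeakRamseyThresholds.
Variables (R : realType) (V : nat -> finType) (G : forall n, sgraph (V n)).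
Variable N : nat -> nat.

(* Pr[F in G(N, p/2) : G is contained in F], along a sequence of graphs G n,
   orders N n and probabilities p n. All quantities are indexed by n rather
   than by N; this is no restriction when n |-> N n is injective. *)
Definition weak_ramsey_prob (p : nat -> R) (n : nat) : R :=
  @er_prob R (N n) (p n / 2) (contains_copy (G n)).

Definition weak_ramsey_upper_threshold (pu : nat -> R) : Prop :=
  (\forall n \near \oo, 0 <= pu n <= 1) /\
  forall p : nat -> R, (forall n, 0 <= p n <= 1) ->
    (\forall n \near \oo, pu n <= p n) ->
    weak_ramsey_prob p n @[n --> \oo] --> (1 : R).

Definition weak_ramsey_lower_threshold (pl : nat -> R) : Prop :=
  (\forall n \near \oo, 0 <= pl n <= 1) /\
  forall p : nat -> R, (forall n, 0 <= p n <= 1) ->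
    (\forall n \near \oo, p n <= pl n) ->
    weak_ramsey_prob p n @[n --> \oo] --> (0 : R).

End WeakRamseyThresholds.

(* Main.v *)
(** For an m-set S of vertices, the number X_S of common neighbours of S outside
S is binomial with parameters N - m and (p/2)^m, so its mean is about
n (1 + delta)^m, resp. n (1 - delta)^m, at the two thresholds.  Chernoff bounds
show that X_S falls on the wrong side of n with probability
O(exp (- n delta^2 / 6)) = O(n^-(m+1)) for M = 6 (m + 1), which beats the at most
N^m choices of S.  Below the threshold no S has n common neighbours, hence there
is no copy.  Above it every m-set has n common neighbours; in particular every
clique on fewer than m vertices extends, so there is an m-clique, and it spans a
copy together with its common neighbours. *)
Require Import Defs.
From mathcomp Require Import all_boot all_order all_algebra.
From mathcomp Require Import all_classical all_reals all_analysis.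
From mathcomp Require Import ring lra.

Import Order.TTheory GRing.Theory Num.Theory.
Import numFieldNormedType.Exports.

Local Open Scope ring_scope.

(** * Common neighbourhoods and finite-set counting *)

Definition common_nbrs {V : finType} (F : sgraph V) (S : {set V}) : {set V} :=
  [set v in ~: S | [forall s in S, [set s; v] \in edges F]].

Lemma bin_leq_expn (N k : nat) : ('C(N, k) <= N ^ k)%N.
Proof.
elim: k N => [|k IH] N; first by rewrite bin0.
case: N => [//|N]; rewrite -(leq_pmul2l (ltn0Sn k)) -mul_bin_diag expnS.
rewrite mulnCA leq_mul2l /= (leq_trans (IH N)) // (leq_trans _ (leq_pmull _ _)) //.
by case: k {IH} => // k; rewrite leq_exp2r.
Qed.

(** Pads a clique on fewer than [m] vertices to an [m]-set, to which the assumption on common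
    neighbours applies. *)
Lemma subset_extension {T : finType} {A B : {set T}} {k : nat} : A \subset B ->
  (#|A| <= k <= #|B|)%N -> exists2 C : {set T}, A \subset C & #|C| = k.
Proof.
elim: k => [|k IH] AB /andP[].
  by rewrite leqn0 => /eqP A0 _; exists A.
rewrite leq_eqVlt => /predU1P[<- _|Ak kB]; first by exists A.
have [|C AC Ck] := IH AB; first by rewrite -ltnS Ak ltnW.
have /fintype.subsetPn[x _ xC] : ~~ (B \subset C).
  by apply: contraL kB => /subset_leq_card; rewrite Ck -leqNgt.
by exists (x |: C); [rewrite subsetU // AC orbT|rewrite cardsU1 xC Ck].
Qed.

(** * Union bound and edge-inclusion probabilities in the random graph *)

Section ERProb.
Context {R : realType} {N : nat}.
Implicit Types (q : R) (A B : pred (sgraph 'I_N)) (E : {set {set 'I_N}}).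

Lemma er_prob_ge0 q A : 0 <= q <= 1 -> 0 <= er_prob q A.
Proof. by move=> q01; apply: sumr_ge0 => F _; exact: er_mass_ge0. Qed.

Lemma er_probC q A : er_prob q (predC A) = 1 - er_prob q A.
Proof.
rewrite -(er_prob_predT N q) /er_prob [X in _ = X - _](bigID A) /= addrAC.
by rewrite subrr add0r.
Qed.

Lemma er_prob_union_bound (I : finType) (P : pred I)
    (B : I -> pred (sgraph 'I_N)) q A : 0 <= q <= 1 ->
  (forall F, A F -> exists2 i, P i & B i F) ->
  er_prob q A <= \sum_(i | P i) er_prob q (B i).
Proof.
move=> q01 AB; rewrite /er_prob.
under [leRHS]eq_bigr do rewrite big_mkcond.
rewrite exchange_big /= [leLHS]big_mkcond; apply: ler_sum => F _.
have mass0 := er_mass_ge0 F q01.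
have term0 i : P i -> 0 <= if B i F then er_mass q F else 0 by case: ifP.
case: ifPn => [/AB[i Pi BiF]|_]; last exact: sumr_ge0.
rewrite (bigD1 i) //= BiF lerDl; apply: sumr_ge0 => j /andP[Pj _].
exact: term0.
Qed.

Lemma er_prob_sub_edges q E : E \subset [set e : {set 'I_N} | #|e| == 2%N] ->
  er_prob q (fun F => E \subset edges F) = q ^+ #|E|.
Proof.
set pairs := [set e | _] => Epairs.
(* [f] and [g] weigh the presence and absence of [e]. With [f] zero off [pairs] and [g] zero on [E],
   only the edge sets of graphs containing [E] survive in the expanded product. *)
pose f e : R := if e \in pairs then q else 0.
pose g e : R := if e \in pairs then (if e \in E then 0 else 1 - q) else 1.
have -> : q ^+ #|E| = \prod_e (f e + g e).
  rewrite -prodr_const [LHS]big_mkcond; apply: eq_bigr => e _; rewrite /f /g.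
  case: ifPn => [/(fintype.subsetP Epairs)->|_]; first by rewrite addr0.
  by case: ifP; rewrite ?subrKC ?add0r.
rewrite bigA_distr /=.
rewrite [RHS](bigID (fun J : {set {set 'I_N}} => (J \subset pairs) && (E \subset J))).
rewrite /= [X in _ = _ + X]big1 => [|J]; last first.
  case/nandP => /fintype.subsetPn[e eX eY].
    by rewrite (bigD1 e) //= eX /f (negbTE eY) mul0r.
  by rewrite (bigD1 e) //= (negbTE eY) /g eX (fintype.subsetP Epairs e eX) mul0r.
rewrite addr0 (reindex_omap (@edges 'I_N) insub) /=; last first.
  by move=> J /andP[JP _]; rewrite -[J]/(val (SGraph JP)) valK.
apply: eq_big => [F|F EF]; first by rewrite valK eqxx andbT edges_pairs.
rewrite /er_mass big_mkcond; apply: eq_bigr => e _; rewrite /f /g inE.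
case: ifPn => ne2; case: ifPn => // eF.
- by rewrite ifN //; apply: contra eF => /(fintype.subsetP EF).
- by have := fintype.subsetP (edges_pairs F) e eF; rewrite inE (negbTE ne2).
Qed.

End ERProb.

(** The binomial theorem as the expansion of a product over all of [T]: a factor outside [A] is
    [0 + 1], which kills every [J] not inside [A]. *)
Lemma sum_subset_expr (R : comPzRingType) (T : finType) (A : {set T}) (x : R) :
  \sum_(J : {set T} | J \subset A) x ^+ #|J| = (1 + x) ^+ #|A|.
Proof.
pose f i : R := if i \in A then x else 0.
have -> : (1 + x) ^+ #|A| = \prod_i (f i + 1).
  rewrite -prodr_const [LHS]big_mkcond; apply: eq_bigr => i _; rewrite /f.
  by case: ifP; rewrite ?add0r // addrC.
rewrite bigA_distr /= [LHS]big_mkcond; apply: eq_bigr => J _.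
case: ifPn => [JA|/fintype.subsetPn[i iJ iA]].
  rewrite -prodr_const [LHS]big_mkcond; apply: eq_bigr => i _; rewrite /f.
  by case: ifPn => // /(fintype.subsetP JA)->.
by rewrite (bigD1 i) //= iJ /f (negbTE iA) mul0r.
Qed.

(** * Generating function of the number of common neighbours *)

Section CommonNeighbours.
Context {R : realType} {N : nat}.
Implicit Types (q z : R) (S J : {set 'I_N}) (F : sgraph 'I_N).

Definition cross_pairs S J : {set {set 'I_N}} :=
  [set [set u.1; u.2] | u in finset.setX S J].

Lemma cross_pairs_pairs S J : J \subset ~: S ->
  cross_pairs S J \subset [set e : {set 'I_N} | #|e| == 2%N].
Proof.
move=> JS; apply/fintype.subsetP => _ /imsetP[[s v] /finset.setXP[/= sS vJ] ->].
suff sv : s != v by rewrite inE cards2 sv.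
by apply: contraL (fintype.subsetP JS v vJ) => /eqP<-; rewrite inE negbK.
Qed.

(** As [J] avoids [S], a cross pair determines which of its endpoints lies in [S], so no pair arises
    twice. *)
Lemma card_cross_pairs S J : J \subset ~: S ->
  #|cross_pairs S J| = (#|S| * #|J|)%N.
Proof.
move=> JS; rewrite card_in_imset ?cardsX // => -[s v] [t w].
move=> /finset.setXP[/= sS vJ] /finset.setXP[/= tS wJ] E.
have vS : v \notin S by have := fintype.subsetP JS v vJ; rewrite inE.
have wS : w \notin S by have := fintype.subsetP JS w wJ; rewrite inE.
have: s \in [set t; w] by rewrite -E set21.
have: v \in [set t; w] by rewrite -E set22.
rewrite !inE => /orP[/eqP vt|/eqP->]; first by rewrite -vt (negbTE vS) in tS.
by case/orP => [/eqP->//|/eqP sw]; rewrite -sw sS in wS.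
Qed.

Lemma sub_common_nbrs S J F :
  (J \subset common_nbrs F S) = (J \subset ~: S) && (cross_pairs S J \subset edges F).
Proof.
apply/fintype.subsetP/andP => [JC|[JS BF] v vJ].
  split; first by apply/fintype.subsetP => v /JC; rewrite inE => /andP[].
  apply/fintype.subsetP => _ /imsetP[[s v] /finset.setXP[/= sS vJ] ->].
  by have := JC v vJ; rewrite inE => /andP[_ /forall_inP/(_ s sS)].
rewrite inE (fintype.subsetP JS) //=; apply/forall_inP => s sS.
by apply: (fintype.subsetP BF); apply/imsetP; exists (s, v) => //; apply/finset.setXP.
Qed.

(* Expanding z^X = \sum_(J \subset common_nbrs F S) (z - 1)^|J| reduces the
   generating function to probabilities that prescribed edges are present. *)
Lemma common_nbrs_gen_fun q z S :
  \sum_F er_mass q F * z ^+ #|common_nbrs F S|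
    = (1 + (z - 1) * q ^+ #|S|) ^+ (N - #|S|).
Proof.
transitivity (\sum_(J : {set 'I_N} | J \subset ~: S) ((z - 1) * q ^+ #|S|) ^+ #|J|); last first.
  by rewrite sum_subset_expr [#|~: S|]cardsCs finset.setCK card_ord.
transitivity (\sum_F \sum_(J : {set 'I_N} | J \subset common_nbrs F S)
    (z - 1) ^+ #|J| * er_mass q F).
  apply: eq_bigr => F _; rewrite -mulr_suml mulrC; congr (_ * _).
  by rewrite sum_subset_expr subrKC.
rewrite (exchange_big_dep (fun J : {set 'I_N} => J \subset ~: S)) /=; last first.
  by move=> F J _; rewrite sub_common_nbrs => /andP[].
apply: eq_bigr => J JS; rewrite -mulr_sumr exprMn -exprM; congr (_ * _).
rewrite -card_cross_pairs // -er_prob_sub_edges ?cross_pairs_pairs //.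
by apply: eq_bigl => F; rewrite sub_common_nbrs JS.
Qed.

(** Markov's inequality for [z] to the number of common neighbours; allowing [z] on either side of 1
    covers both tails. *)
Lemma common_nbrs_markov q z S (a : R) (A : pred (sgraph 'I_N)) :
    0 <= q <= 1 -> 0 <= z -> 0 < a ->
  (forall F, A F -> a <= z ^+ #|common_nbrs F S|) ->
  er_prob q A <= a^-1 * (1 + (z - 1) * q ^+ #|S|) ^+ (N - #|S|).
Proof.
move=> q01 z0 a0 Aa; rewrite mulrC ler_pdivlMr // -common_nbrs_gen_fun.
rewrite /er_prob mulr_suml [leLHS]big_mkcond; apply: ler_sum => F _.
have mass0 := er_mass_ge0 F q01.
case: ifPn => [/Aa ?|_]; first exact: ler_wpM2l.
by rewrite mulr_ge0 ?exprn_ge0.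
Qed.

End CommonNeighbours.

(** * Chernoff bounds for a fixed vertex set *)

Lemma expR_ge_quadratic (R : realType) (x : R) : -1 <= x <= 1 ->
  1 + x <= expR (x - x ^+ 2 / 6).
Proof.
move=> x1; have x2 := sqr_ge0 x.
(* Put y = x - x^2/6. Squaring exp(y/2) >= 1 + y/2 gives the lower bound 1 + x + x^2 (1 - x)/12 +
   x^4/144 for exp(y). *)
have e2 := expR_ge1Dx ((x - x ^+ 2 / 6) / 2).
have -> : x - x ^+ 2 / 6 = (x - x ^+ 2 / 6) / 2 + (x - x ^+ 2 / 6) / 2 by lra.
rewrite expRD -expr2; apply: (@le_trans _ _ ((1 + (x - x ^+ 2 / 6) / 2) ^+ 2)).
  have : 0 <= x ^+ 2 * (1 - x) /\ 0 <= (x ^+ 2) ^+ 2.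
    by split; [rewrite mulr_ge0 //; lra|exact: sqr_ge0].
  by move=> [? ?]; lra.
by apply: lerXn2r; rewrite ?nnegrE ?expR_ge0 //; nra.
Qed.

(* The choice z = 1 / (1 + x) in Markov's inequality serves both tails:
   x > 0 for the lower one, x < 0 for the upper one. *)
Lemma common_nbrs_chernoff (R : realType) (N n : nat) (q x K : R)
    (S : {set 'I_N}) (A : pred (sgraph 'I_N)) :
    0 <= q <= 1 -> -1 < x <= 1 ->
    (forall F, A F -> if x <= 0 then (n <= #|common_nbrs F S|)%N
                      else (#|common_nbrs F S| <= n)%N) ->
    n%:R * (x * (1 + x)) - K <= (N - #|S|)%:R * q ^+ #|S| * x ->
  er_prob q A <= expR (K / (1 + x) - n%:R * x ^+ 2 / 6).
Proof.
move=> q01 /andP[xN1 x1] An mean.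
have y0 : 0 < 1 + x by lra.
have yV0 : 0 < (1 + x)^-1 by rewrite invr_gt0.
apply: le_trans (@common_nbrs_markov R N q (1 + x)^-1 S ((1 + x)^-1 ^+ n) A
  q01 (ltW yV0) (exprn_gt0 _ yV0) _) _ => [F /An|].
  (* The base (1 + x)^-1 is at least 1 if x <= 0 and below 1 otherwise, so in both cases the event
     bounds its power from below by its [n]-th power. *)
  case: ifP => x0 nX.
    by rewrite ler_weXn2l // invf_ge1 //; lra.
  by rewrite ler_wiXn2l // ?(ltW yV0) // invf_le1 //; move/negbT: x0; lra.
rewrite exprVn invrK.
have q1 : q ^+ #|S| <= 1 by case/andP: q01 => *; rewrite exprn_ile1.
have q0 : 0 <= q ^+ #|S| by case/andP: q01 => *; rewrite exprn_ge0.
have zE : (1 + x)^-1 - 1 = - (x / (1 + x)) by field; lra.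
set t := ((1 + x)^-1 - 1) * q ^+ #|S|.
have t1 : 0 <= 1 + t.
  by rewrite /t; nra.
apply: (@le_trans _ _ (expR (x - x ^+ 2 / 6) ^+ n * expR t ^+ (N - #|S|))).
  apply: ler_pM; rewrite ?exprn_ge0 ?(ltW y0) //.
    by apply: lerXn2r; rewrite ?nnegrE ?expR_ge0 ?(ltW y0) // expR_ge_quadratic; lra.
  by apply: lerXn2r; rewrite ?nnegrE ?expR_ge0 // expR_ge1Dx.
rewrite -!expRM_natl -expRD ler_expR.
(* This is the hypothesis [mean] multiplied by -1/(1 + x). *)
suff: (N - #|S|)%:R * t <= K / (1 + x) - n%:R * x by lra.
rewrite /t zE -(ler_pM2r y0).
have -> : (N - #|S|)%:R * (- (x / (1 + x)) * q ^+ #|S|) * (1 + x)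
  = - ((N - #|S|)%:R * q ^+ #|S| * x) by field; lra.
have -> : (K / (1 + x) - n%:R * x) * (1 + x) = K - n%:R * (x * (1 + x)).
  by field; lra.
lra.
Qed.

(** * Copies of the join in terms of common neighbours *)

Lemma contains_Kjoin_common_nbrs (V : finType) (m n : nat) (F : sgraph V) :
  contains_copy (Kjoin m n) F ->
  exists2 S : {set V}, #|S| == m & (n <= #|common_nbrs F S|)%N.
Proof.
case/existsP => f /andP[/injectiveP finj /forall_inP fE].
exists [set f (inl i) | i in 'I_m].
  by rewrite card_imset ?card_ord // => i j /finj[].
rewrite -[n in (n <= _)%N]card_ord -(card_imset (f := fun j : 'I_n => f (inr j))).
  apply/subset_leq_card/fintype.subsetP => _ /imsetP[j _ ->].
  rewrite !inE; apply/andP; split.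
    by apply/imsetP => -[i _ /finj].
  apply/forall_inP => _ /imsetP[i _ ->].
  have := fE [set inl i; inr j]; rewrite imsetU1 imset_set1; apply.
  by rewrite inE cards2 /=; apply/existsP; exists i; rewrite set21.
by move=> i j /finj[].
Qed.

Lemma injection_into {T : finType} {A : {set T}} {k : nat} : (k <= #|A|)%N ->
  exists2 g : 'I_k -> T, injective g & forall i, g i \in A.
Proof.
move=> kA; exists (fun i => enum_val (widen_ord kA i)) => [i j|i].
  by move=> /enum_val_inj/(congr1 val) /= /val_inj.
exact: enum_valP.
Qed.

Lemma common_nbrs_contains_Kjoin (V : finType) (m n : nat) (F : sgraph V) :
    (0 < n)%N -> (m <= #|V|)%N ->
    (forall S : {set V}, #|S| = m -> (n <= #|common_nbrs F S|)%N) ->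
  contains_copy (Kjoin m n) F.
Proof.
move=> n0 mV nbrs.
have [S [Sm clique]] : exists S : {set V}, #|S| = m /\
    forall u v, u \in S -> v \in S -> u != v -> [set u; v] \in edges F.
  suff /(_ m (leqnn m)) : forall k, (k <= m)%N -> exists S : {set V},
    #|S| = k /\ forall u v, u \in S -> v \in S -> u != v -> [set u; v] \in edges F.
    by [].
  elim=> [|k IH] km.
    by exists finset.set0; rewrite cards0; split=> // u v; rewrite inE.
  have [S [Sk clique]] := IH (ltnW km).
  (* A common neighbour [w] of an [m]-set [T] containing [S] lies outside [T] and is adjacent to the
     whole clique [S]; [0 < n] provides one. *)
  have [|T ST Tm] := subset_extension (finset.subsetT S) (k := m).
    by rewrite Sk ltnW //= cardsT.
  have /card_gt0P[w] := leq_trans n0 (nbrs T Tm).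
  rewrite inE => /andP[]; rewrite inE => wT /forall_inP wE.
  have wS : w \notin S by apply: contra wT => /(fintype.subsetP ST).
  have {}wE s : s \in S -> [set s; w] \in edges F.
    by move=> /(fintype.subsetP ST)/wE.
  exists (w |: S); rewrite cardsU1 wS Sk; split=> // u v.
  rewrite !inE => /predU1P[->|uS] /predU1P[->|vS]; rewrite ?eqxx //.
  - by rewrite finset.setUC => _; exact: wE.
  - by move=> _; exact: wE.
  - exact: clique.
have [g ginj gS] : exists2 g : 'I_m -> V, injective g & forall i, g i \in S.
  by apply: injection_into; rewrite Sm.
have [h hinj hN] := injection_into (nbrs S Sm).
have hS j : h j \notin S by have := hN j; rewrite !inE => /andP[].
pose f : {ffun ('I_m + 'I_n)%type -> V} := [ffun u => match u with inl i => g i | inr j => h j end].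
(* Every edge of the join has an end [inl i]; read from that end, it maps to a clique edge or to an
   edge towards a common neighbour. *)
have gE i y : inl i != y -> [set f (inl i); f y] \in edges F.
  case: y => [i' ii'|j _]; rewrite !ffunE.
    by apply: clique => //; apply: contra ii' => /eqP/ginj->.
  by have := hN j; rewrite inE => /andP[_ /forall_inP]; apply.
apply/existsP; exists f; apply/andP; split.
  apply/injectiveP => -[i|i] [j|j]; rewrite !ffunE.
  - by move=> /ginj->.
  - by move=> E; have := hS j; rewrite -E gS.
  - by move=> E; have := hS i; rewrite E gS.
  - by move=> /hinj->.
apply/forall_inP => e; rewrite inE => /andP[/cards2P[x [y [xy ->]]] /existsP[i]].
rewrite imsetU1 imset_set1 !inE => /orP[/eqP E|/eqP E]; rewrite -{}E in xy *.
  exact: gE.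
by rewrite finset.setUC; apply: gE; rewrite eq_sym.
Qed.

(** * Union bound over [m]-sets, and asymptotics of the deviation *)

Local Open Scope classical_set_scope.
Local Open Scope ring_scope.

(** The factor [x] in the last hypothesis makes it a lower or an upper bound on the mean according
    to the sign of [x]; [K] is an additive slack. *)
Lemma er_prob_nbrs_tail (R : realType) (N m n : nat) (q x K : R)
    (A : pred (sgraph 'I_N)) :
    0 <= q <= 1 -> -1 < x <= 1 ->
    (forall F, A F -> exists2 S : {set 'I_N}, #|S| == m &
       if x <= 0 then (n <= #|common_nbrs F S|)%N
       else (#|common_nbrs F S| <= n)%N) ->
    n%:R * (x * (1 + x)) - K <= (N - m)%:R * q ^+ m * x ->
  er_prob q A <= N%:R ^+ m * expR (K / (1 + x) - n%:R * x ^+ 2 / 6).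
Proof.
move=> q01 x1 AS mean.
pose B S := [pred F : sgraph 'I_N | if x <= 0 then (n <= #|common_nbrs F S|)%N
  else (#|common_nbrs F S| <= n)%N].
apply: le_trans (er_prob_union_bound _ _ B q A q01 AS) _.
apply: (@le_trans _ _ (\sum_(S : {set 'I_N} | #|S| == m)
    expR (K / (1 + x) - n%:R * x ^+ 2 / 6))).
  apply: ler_sum => S /eqP Sm; apply: (common_nbrs_chernoff R N n q x K S) => //; last by rewrite Sm.
rewrite sumr_const -[leLHS]mulr_natl; apply: ler_wpM2r; first exact: expR_ge0.
rewrite -natrX ler_nat (leq_trans _ (bin_leq_expn N m)) //.
by rewrite -[N in 'C(N, m)]card_ord -card_draws cardsE.
Qed.

(** For y = ln x, exp(y) >= 1 + y^2/2 gives y^2 <= 2 (x - 1), whereas y > a x would give y^2 >= a^2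
    x^2 >= 2 x. *)
Lemma ln_le_linear (R : realType) (a x : R) :
  0 < a -> 1 <= x -> 2 / a ^+ 2 <= x -> ln x <= a * x.
Proof.
move=> a0 x1 ax; have y0 := ln_ge0 x1.
have a2 : 2 <= a ^+ 2 * x by move: ax; rewrite ler_pdivrMr ?exprn_gt0 // mulrC.
have := expR_ge1Dxn 1 y0; rewrite lnK ?posrE ?(lt_le_trans ltr01) //.
rewrite -[2`!%:R]/(2 : R) => xy.
have [//|axy] := leP (ln x) (a * x).
have : 2 * x <= (a * x) ^+ 2 by rewrite exprMn [x ^+ 2]expr2 mulrA; nra.
have : (a * x) ^+ 2 <= ln x ^+ 2 by apply: lerXn2r; rewrite ?nnegrE //; nra.
lra.
Qed.

Section Deviation.
Context {R : realType} {M : R}.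
Hypothesis M0 : 0 < M.

Let delta n : R := Num.sqrt (M * ln n%:R / n%:R).

Lemma deviation_near (e : R) : 0 < e -> \forall n \near \oo, delta n <= e.
Proof.
move=> e0; near=> n.
have n0 : 0 < n%:R :> R by rewrite ltr0n; near: n; exact: nbhs_infty_gt.
rewrite /delta -(ger0_norm (ltW e0)) -sqrtr_sqr ler_sqrt ?sqr_ge0 //.
rewrite ler_pdivrMr // mulrC -ler_pdivlMr // mulrAC.
apply: ln_le_linear; first by rewrite divr_gt0 ?exprn_gt0.
  by rewrite ler1n -(ltr0n R).
by near: n; exact: nbhs_infty_ger.
Unshelve. all: by end_near. Qed.

Lemma sqr_deviation n : (0 < n)%N -> n%:R * delta n ^+ 2 = M * ln n%:R.
Proof.
move=> n0; have n0' : n%:R != 0 :> R by rewrite pnatr_eq0 -lt0n.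
rewrite sqr_sqrtr; first by rewrite mulrC divfK.
by rewrite !mulr_ge0 ?invr_ge0 ?ln_ge0 ?ler1n // ltW.
Qed.

End Deviation.

Lemma cvg0_of_le_inv {R : realType} (D : R) (u : nat -> R) :
  (\forall n \near \oo, 0 <= u n <= D / n%:R) -> u n @[n --> \oo] --> (0 : R).
Proof.
(* [harmonic n] is 1/(n + 1); the factor 2 comes from 1/n <= 2/(n + 1) for n >= 1. *)
move=> uD; apply: (squeeze_cvgr (f := fun=> 0) (h := fun n => 2 * D * harmonic n)).
- near=> n.
  have /andP[-> un] : 0 <= u n <= D / n%:R by near: n.
  have n0 : (0 < n)%N by near: n; exact: nbhs_infty_gt.
  have n0' : 0 < n%:R :> R by rewrite ltr0n.
  have D0 : 0 <= D.
    have /andP[u0 _] : 0 <= u n <= D / n%:R by near: n.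
    by rewrite -(pmulr_lge0 _ (_ : 0 < n%:R^-1)) ?invr_gt0 //; apply: le_trans un.
  rewrite /= (le_trans un) // -[2 * D]mulrC -mulrA ler_wpM2l //.
  rewrite /harmonic /= ler_pdivlMr ?ltr0n // mulrC ler_pdivrMr //.
  by rewrite -natrM ler_nat mul2n -addnn -addn1 leq_add2l.
- exact: cvg_cst.
- by rewrite -(mulr0 (2 * D)); apply: cvgM; [exact: cvg_cst|exact: cvg_harmonic].
Unshelve. all: by end_near. Qed.

(** * The two thresholds *)

Section Thresholds.
Context {R : realType} {m : nat} {c : R}.
Hypotheses (m_gt0 : (1 <= m)%N) (c_gt1 : 1 < c).

Let b := c `^ m%:R^-1.
Let N (n : nat) : nat := Num.truncn (c * 2 ^+ m * n%:R).
Let M : R := 6 * m.+1%:R.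
Let delta (n : nat) : R := Num.sqrt (M * ln n%:R / n%:R).

Let c_gt0 : 0 < c. Proof. exact: lt_trans ltr01 c_gt1. Qed.

Let scale_gt0 : 0 < c * 2 ^+ m.
Proof. by rewrite mulr_gt0 ?exprn_gt0. Qed.

Let M_gt0 : 0 < M. Proof. by rewrite mulr_gt0 ?ltr0n. Qed.

Let b_exp : b ^+ m = c.
Proof.
rewrite /b -powR_mulrn ?powR_ge0 // -powRrM mulVf ?pnatr_eq0 -?lt0n //.
by rewrite powRr1 // ltW.
Qed.

Let b_gt1 : 1 < b.
Proof.
have b0 : 0 < b by rewrite powR_gt0.
rewrite ltNge; apply/negP => b1; suff : c <= 1 by rewrite leNgt c_gt1.
by rewrite -b_exp exprn_ile1 // ltW.
Qed.

Let b_gt0 : 0 < b. Proof. exact: lt_trans ltr01 b_gt1. Qed.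

Let bV_ge0 : 0 <= b^-1. Proof. by rewrite invr_ge0 ltW. Qed.

(** The denominator cancels the factor c 2^m of the order, so at p = y/b the mean N (p/2)^m is about
    n y^m. *)
Let half_exp (y : R) : (b^-1 * y / 2) ^+ m = y ^+ m / (c * 2 ^+ m).
Proof.
rewrite -mulrA exprMn exprVn b_exp exprMn exprVn invfM.
by rewrite mulrCA mulrA.
Qed.

Let order_bounds n : (N n)%:R <= c * 2 ^+ m * n%:R < (N n).+1%:R.
Proof. by apply: truncn_itv; rewrite mulr_ge0 // ltW. Qed.

(** The choice of [M] turns exp(-n delta^2/6) into n^-(m+1); against N^m <= (c 2^m n)^m a factor 1/n
    remains. *)
Let tail_bound (n : nat) (q x K : R) (A : pred (sgraph 'I_(N n))) :
    (0 < n)%N -> 0 <= q <= 1 -> -1 < x <= 1 -> 0 <= K ->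
    x ^+ 2 = delta n ^+ 2 ->
    (forall F, A F -> exists2 S : {set 'I_(N n)}, #|S| == m &
       if x <= 0 then (n <= #|common_nbrs F S|)%N
       else (#|common_nbrs F S| <= n)%N) ->
    n%:R * (x * (1 + x)) - K <= (N n - m)%:R * q ^+ m * x ->
  er_prob q A <= (c * 2 ^+ m) ^+ m * expR (K / (1 + x)) / n%:R.
Proof.
move=> n0 q01 x1 K0 xd AS mean.
have n0' : 0 < n%:R :> R by rewrite ltr0n.
apply: le_trans (er_prob_nbrs_tail _ _ _ _ _ _ _ _ q01 x1 AS mean) _.
rewrite expRD xd sqr_deviation //.
have -> : - (M * ln n%:R / 6) = - (m.+1%:R * ln n%:R) by rewrite /M; field.
rewrite expRN expRM_natl lnK ?posrE // exprS invfM.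
have -> : (c * 2 ^+ m) ^+ m * expR (K / (1 + x)) / n%:R
  = (c * 2 ^+ m * n%:R) ^+ m * (expR (K / (1 + x)) * (n%:R^-1 * (n%:R ^+ m)^-1)).
  by rewrite [in RHS]exprMn; field; rewrite expf_neq0 ?gt_eqF.
apply: ler_wpM2r.
  by rewrite !mulr_ge0 ?expR_ge0 ?invr_ge0 ?exprn_ge0.
have /andP[NU _] := order_bounds n.
by apply: lerXn2r; rewrite ?nnegrE ?(le_trans _ NU).
Qed.

Lemma Kjoin_lower_threshold :
  weak_ramsey_lower_threshold (Kjoin m) N (fun n => b^-1 * (1 - delta n)).
Proof.
split=> [|p p01 ple].
  near=> n.
  have d1 : delta n <= 1 by near: n; exact: (deviation_near M_gt0).
  have d0 : 0 <= delta n by exact: sqrtr_ge0.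
  rewrite mulr_ge0 ?bV_ge0 ?subr_ge0 //= mulrC ler_pdivrMr //.
  by rewrite mul1r; move: b_gt1; lra.
apply: (@cvg0_of_le_inv _ ((c * 2 ^+ m) ^+ m)).
near=> n.
have d1 : delta n <= 1 / 2 by near: n; apply: (deviation_near M_gt0); lra.
have d0 : 0 <= delta n by exact: sqrtr_ge0.
have n0 : (0 < n)%N by near: n; exact: nbhs_infty_gt.
have pn : p n <= b^-1 * (1 - delta n) by near: n.
have /andP[p0 p1] := p01 n.
have q01 : 0 <= p n / 2 <= 1 by apply/andP; split; lra.
rewrite er_prob_ge0 //=.
(* The slack is 0: rounding down in [N n] and removing the [m] vertices only lower the mean, which
   is the favourable direction. *)
have := @tail_bound n (p n / 2) (- delta n) 0 (contains_copy (Kjoin m n)).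
rewrite mul0r expR0 mulr1; apply=> //; rewrite ?sqrrN //.
- by apply/andP; split; lra.
- by move=> F /contains_Kjoin_common_nbrs; rewrite oppr_le0 d0.
rewrite subr0 -[leLHS]/(n%:R * (- delta n * (1 - delta n))) !mulNr !mulrN lerN2.
rewrite [n%:R * _]mulrCA mulrC ler_wpM2l //.
(* The linear bound (1 - delta)^m <= 1 - delta, from m >= 1, is enough for the tail estimate. *)
have qm : (p n / 2) ^+ m <= (1 - delta n) / (c * 2 ^+ m).
  apply: (@le_trans _ _ ((1 - delta n) ^+ m / (c * 2 ^+ m))).
    rewrite -half_exp; apply: lerXn2r; rewrite ?nnegrE; [lra| |lra].
    by rewrite !mulr_ge0 // subr_ge0; lra.
  rewrite ler_wpM2r ?invr_ge0 ?(ltW scale_gt0) // -{1}(prednK m_gt0) exprS ler_piMr //.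
    lra.
  by rewrite exprn_ile1 //; lra.
apply: (@le_trans _ _ ((c * 2 ^+ m * n%:R) * ((1 - delta n) / (c * 2 ^+ m)))).
  apply: ler_pM => //; first by rewrite exprn_ge0 //; lra.
  have /andP[NU _] := order_bounds n.
  by apply: le_trans NU; rewrite ler_nat leq_subr.
by rewrite le_eqVlt; apply/orP; left; apply/eqP; field; rewrite expf_neq0 ?gt_eqF.
Unshelve. all: by end_near. Qed.

Lemma Kjoin_upper_threshold :
  weak_ramsey_upper_threshold (Kjoin m) N (fun n => b^-1 * (1 + delta n)).
Proof.
split=> [|p p01 ple].
  near=> n.
  (* Since c > 1 gives b > 1, the margin b - 1 keeps the threshold at most 1. *)
  have d1 : delta n <= b - 1.
    by near: n; apply: (deviation_near M_gt0); rewrite subr_gt0.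
  have d0 : 0 <= delta n by exact: sqrtr_ge0.
  rewrite mulr_ge0 ?bV_ge0 ?addr_ge0 //= mulrC ler_pdivrMr //.
  by rewrite mul1r; lra.
(* K accounts for the m vertices of S itself and for the rounding in N n. *)
pose K : R := 2 * m.+1%:R.
have K0 : 0 <= K by rewrite mulr_ge0.
suff cvg0 : 1 - weak_ramsey_prob (Kjoin m) N p n @[n --> \oo] --> (0 : R).
  have -> : weak_ramsey_prob (Kjoin m) N p
      = fun n => 1 - (1 - weak_ramsey_prob (Kjoin m) N p n).
    by apply/funext => n; rewrite subKr.
  by rewrite -[X in _ --> X]subr0; apply: cvgB => //; exact: cvg_cst.
apply: (@cvg0_of_le_inv _ ((c * 2 ^+ m) ^+ m * expR K)).
near=> n.
have d1 : delta n <= 1 by near: n; exact: (deviation_near M_gt0).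
have d0 : 0 <= delta n by exact: sqrtr_ge0.
have n1 : (1 < n)%N by near: n; exact: nbhs_infty_gt.
have n0 : (0 < n)%N by exact: ltnW.
(* Strict positivity, from n > 1, makes the test [x <= 0] in [tail_bound] select the lower tail. *)
have dn : 0 < delta n.
  by rewrite sqrtr_gt0 divr_gt0 ?mulr_gt0 ?ln_gt0 ?ltr1n ?ltr0n.
have pn : b^-1 * (1 + delta n) <= p n by near: n.
have /andP[p0 p1] := p01 n.
have /andP[NU NL] := order_bounds n.
have q01 : 0 <= p n / 2 <= 1 by apply/andP; split; lra.
have c1 : 1 <= c * 2 ^+ m by rewrite mulr_ege1 ?(ltW c_gt1) // exprn_ege1 // ler1n.
have mN : (m <= N n)%N.
  have : m.+1%:R <= n%:R :> R by near: n; exact: nbhs_infty_ger.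
  move=> mn; rewrite -ltnS -(ltr_nat R); apply: le_lt_trans NL.
  have mm : m%:R <= m.+1%:R :> R by rewrite ler_nat.
  by rewrite (le_trans mm) // (le_trans mn) // ler_peMl.
rewrite -er_probC er_prob_ge0 //=.
apply: le_trans (@tail_bound n (p n / 2) (delta n) K _ _ _ _ _ _ _ _) _ => //.
- by apply/andP; split; lra.
(* If no [m]-set had at most [n] common neighbours, all would have more than [n], which yields a
   copy. *)
- move=> F; rewrite leNgt dn /= => /negP nF.
  apply: contra_notP nF => /forall2NP nbrs.
  apply: common_nbrs_contains_Kjoin => // [|S Sm]; first by rewrite card_ord.
  case: (nbrs S) => [[]|/negP]; first exact/eqP.
  by rewrite -ltnNge => /ltnW.
- have qm : (1 + delta n) / (c * 2 ^+ m) <= (p n / 2) ^+ m.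
    apply: (@le_trans _ _ ((1 + delta n) ^+ m / (c * 2 ^+ m))).
      rewrite ler_wpM2r ?invr_ge0 ?(ltW scale_gt0) // -{1}(prednK m_gt0) exprS ler_peMr //.
        lra.
      by rewrite exprn_ege1 //; lra.
    rewrite -half_exp; apply: lerXn2r; rewrite ?nnegrE; [|lra|lra].
    by rewrite !mulr_ge0 // addr_ge0.
  (* Rounding loses less than 1, and removing the vertices of an [m]-set loses [m]. *)
  have Nm : c * 2 ^+ m * n%:R - m.+1%:R <= (N n - m)%:R.
    by rewrite natrB // -natr1; move: NL; rewrite -natr1; lra.
  have mean : n%:R * (1 + delta n) - K <= (N n - m)%:R * (p n / 2) ^+ m.
    apply: (@le_trans _ _ ((N n - m)%:R * ((1 + delta n) / (c * 2 ^+ m)))).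
      apply: le_trans (ler_wpM2r _ Nm); last first.
        by rewrite divr_ge0 ?(ltW scale_gt0) //; lra.
      (* The lost term is (m + 1)(1 + delta)/(c 2^m), at most [K] because delta <= 1 <= c 2^m. *)
      rewrite mulrBl [c * 2 ^+ m * n%:R]mulrC -[in leRHS]mulrA [_ * (_ / _)]mulrCA.
      rewrite divff ?gt_eqF // mulr1 lerD2l lerN2 /K [leLHS]mulrA.
      rewrite ler_pdivrMr // [2 * _]mulrC -mulrA ler_wpM2l //; nra.
    by rewrite ler_wpM2l.
  (* After multiplication by delta <= 1 the error is K delta <= K. *)
  have : (n%:R * (1 + delta n) - K) * delta n
      <= (N n - m)%:R * (p n / 2) ^+ m * delta n by rewrite ler_wpM2r.
  nra.
(* K/(1 + delta) <= K makes the constant independent of [n]. *)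
rewrite ler_wpM2r ?invr_ge0 // ler_wpM2l ?exprn_ge0 ?(ltW scale_gt0) //.
rewrite ler_expR ler_pdivrMr; last lra.
by rewrite ler_peMr //; lra.
Unshelve. all: by end_near. Qed.

End Thresholds.

Theorem theorem5 (R : realType) (m : nat) (c : R) (hm : (1 <= m)%N)
    (hc : 1 < c) :
  let N (n : nat) : nat := Num.truncn (c * 2 ^+ m * n%:R) in
  exists M : R, 0 < M /\
    weak_ramsey_upper_threshold (Kjoin m) N
      (fun n => (c `^ (m%:R^-1))^-1 * (1 + Num.sqrt (M * ln n%:R / n%:R))) /\
    weak_ramsey_lower_threshold (Kjoin m) N
      (fun n => (c `^ (m%:R^-1))^-1 * (1 - Num.sqrt (M * ln n%:R / n%:R))).
Proof.
move=> N; exists (6 * m.+1%:R); split; first by rewrite mulr_gt0 ?ltr0n.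
by split; [exact: Kjoin_upper_threshold|exact: Kjoin_lower_threshold].
Qed.
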